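(* Consider the linear time-varying (LTV) filter $$\dot\chi=\Delta(Y-\Delta\chi),\qquad \dot\Xi=-\Delta^2\Xi,\quad \Xi(0)=1,$$ with $\chi(0)\in\mathbb{R}^6$, and the extended scalar regressor $\Delta_{\tt N}(t)=\Delta(t)+k_{\tt N}(1-\Xi(t))$, $k_{\tt N}>0$, where $Y$ and $\Delta$ are generated from the rigid-body dynamics as described in the context. Then: (1) The LTV filter is internally stable. (2) $\Delta_{\tt N}(t)\ge0$ for all $t\in[0,\infty)$. (3) If there exist $t_s>0$ and $t_c>0$ such that $W_a^\top$ is of interval excitation over $[t_s,t_s+t_c]$, then there exists a constant $\hbar>0$ such that $\Delta_{\tt N}(t)>\hbar$ for all $t\in[t_s+t_c,\infty)$.
   Context: $S(x)$ is the $3\times3$ matrix with $S(x)y=x\times y$. The angular velocity $\omega(t)\in\mathbb{R}^3$ satisfies $J\dot\omega=-S(\omega)J\omega+u$ on $[0,\infty)$, with $J=J^\top\in\mathbb{R}^{3\times3}$ positive definite, constant and diagonal (but otherwise unknown), and control torque $u(t)\in\mathbb{R}^3$. Let $\theta=[J_{11},J_{22},J_{33},J_{23},J_{13},J_{12}]^\top$ and $$L[x]=\begin{bmatrix}x_1&0&0&0&x_3&x_2\\0&x_2&0&x_3&0&x_1\\0&0&x_3&x_2&x_1&0\end{bmatrix},$$ so that $Jx=L[x]\theta$ for $x\in\mathbb{R}^3$. Let $W=-S(\omega)L[\omega]$ and, with constant $a>0$, $\dot\omega_f=-a\omega_f+\omega$, $\dot W_f=-aW_f+W$, $\dot u_f=-au_f+u$,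 with $\omega_f(0)=\omega(0)/a$, $W_f(0)=0$, $u_f(0)=0$. Let $W_a=L[\dot\omega_f]-W_f\in\mathbb{R}^{3\times6}$; then $u_f=W_a\theta$. With constant $b>0$: $\dot M=-bM+W_a^\top u_f$, $M(0)=0\in\mathbb{R}^6$; $\dot N=-bN+W_a^\top W_a$, $N(0)=0\in\mathbb{R}^{6\times6}$; then $M=N\theta$. With a constant gain $k_{\tt I}\ge1$, $Y=k_{\tt I}\,\mathrm{adj}\{N\}M$ and $\Delta=k_{\tt I}\det\{N\}$, so that $Y=\Delta\theta$. Interval excitation (IE): a bounded signal $X(t)\in\mathbb{R}^{m\times n}$ is of IE over $[t_s,t_s+t_c]$ if there is $\nu>0$ such that $\int_{t_s}^{t_s+t_c}X(\tau)X^\top(\tau)\,d\tau\ge\nu I_m$. Internal stability of the LTV filter means that the zero solution of its homogeneous part $\dot x=-\Delta^2(t)x$ is Lyapunov stable and that the filter states $\chi(t)$, $\Xi(t)$ remain bounded for all $t\ge0$. *)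

(* Defs.v *)
From HB Require Import structures.
From mathcomp Require Import all_boot all_order all_algebra.
From mathcomp Require Import all_classical all_reals all_analysis.

Set Implicit Arguments.
Unset Strict Implicit.
Unset Printing Implicit Defensive.

Import Order.TTheory GRing.Theory Num.Theory.
Import numFieldNormedType.Exports.

Local Open Scope classical_set_scope.
Local Open Scope ring_scope.

Section Signals.
Context {R : realType}.

(* Derivative on the half line [t0, +oo[: two-sided for t > t0 and one-sided
   at t0, so that the values of x before t0 are irrelevant. *)
Definition deriv_from (V : normedModType R) (t0 : R) (x dx : R -> V) : Prop :=
  forall t, t0 <= t ->
    h^-1 *: (x (t + h) - x t) @[h --> within [set h | t0 <= t + h] 0^']
      --> dx t.

Definition bounded_signal (V : normedModType R) (x : R -> V) : Prop :=
  [bounded x t | t in `[0, +oo[%classic].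

Definition quad n (A : 'M[R]_n) (v : 'cV[R]_n) : R := (v^T *m A *m v) 0 0.

Definition posdef n (A : 'M[R]_n) : Prop := forall v, v != 0 -> 0 < quad A v.

Definition possemidef n (A : 'M[R]_n) : Prop := forall v, 0 <= quad A v.

Definition mxintegral m n (D : set R) (F : R -> 'M[R]_(m, n)) : 'M[R]_(m, n) :=
  \matrix_(i, j) (\int[lebesgue_measure]_(t in D) F t i j).

Definition interval_excitation m n (X : R -> 'M[R]_(m, n)) (ts tc : R) :
    Prop :=
  bounded_signal X /\
  exists2 nu : R, 0 < nu &
    possemidef (mxintegral `[ts, ts + tc] (fun t => X t *m (X t)^T) - nu%:M).

(* Lyapunov stability of the zero solution of x' = f t x on [0, +oo[. *)
Definition zero_lyapunov_stable (V : normedModType R) (f : R -> V -> V) : Prop :=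
  forall t0 eps : R, 0 <= t0 -> 0 < eps ->
  exists2 delta : R, 0 < delta &
    forall x : R -> V, deriv_from t0 x (fun t => f t (x t)) ->
      `|x t0| < delta -> forall t, t0 <= t -> `|x t| < eps.

(* The state of the filter is the pair (chi, Xi), of dimension p + 1. *)
Definition internally_stable p (Delta : R -> R)
    (chi : R -> 'cV[R]_p) (Xi : R -> R) : Prop :=
  [/\ zero_lyapunov_stable
        (fun t (x : 'cV[R]_(p + 1)) => - (Delta t) ^+ 2 *: x),
      bounded_signal chi
    & bounded_signal Xi].

End Signals.

Section RigidBody.
Context {R : realType}.
Implicit Types (x y : 'cV[R]_3) (J : 'M[R]_3).

Definition cross x y : 'cV[R]_3 :=
  \col_i [:: x 1 0 * y 2 0 - x 2 0 * y 1 0;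
             x 2 0 * y 0 0 - x 0 0 * y 2 0;
             x 0 0 * y 1 0 - x 1 0 * y 0 0]`_i.

Definition mx_of_rows m n (s : seq (seq R)) : 'M[R]_(m, n) :=
  \matrix_(i, j) (nth [::] s i)`_j.

Definition cross_mx x : 'M[R]_3 := mx_of_rows 3 3
  [:: [:: 0;        - x 2 0; x 1 0];
      [:: x 2 0;    0;       - x 0 0];
      [:: - x 1 0;  x 0 0;   0]].

Definition Lmx x : 'M[R]_(3, 6) := mx_of_rows 3 6
  [:: [:: x 0 0; 0;     0;     0;     x 2 0; x 1 0];
      [:: 0;     x 1 0; 0;     x 2 0; 0;     x 0 0];
      [:: 0;     0;     x 2 0; x 1 0; x 0 0; 0]].

Definition theta J : 'cV[R]_6 :=
  \col_i [:: J 0 0; J 1 1; J 2 2; J 1 2; J 0 2; J 0 1]`_i.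

Lemma cross_mxE x y : cross_mx x *m y = cross x y.
Proof.
apply/colP => i; rewrite !mxE !big_ord_recl big_ord0 !mxE.
have -> : lift ord0 (ord0 : 'I_2) = 1 :> 'I_3 by exact: val_inj.
have -> : lift ord0 (lift ord0 (ord0 : 'I_1)) = 2 :> 'I_3 by exact: val_inj.
by case: i => -[|[|[|//]]] lti /=;
  rewrite mul0r ?addr0 ?add0r mulNr // addrC.
Qed.

Lemma Lmx_theta J x : J^T = J -> J *m x = Lmx x *m theta J.
Proof.
move=> Jsym; have JC i j : J i j = J j i by rewrite -{1}Jsym mxE.
apply/colP => i; rewrite !mxE !big_ord_recl !big_ord0 !mxE /=.
have -> : lift ord0 (ord0 : 'I_2) = 1 :> 'I_3 by exact: val_inj.
have -> : lift ord0 (lift ord0 (ord0 : 'I_1)) = 2 :> 'I_3 by exact: val_inj.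
case: i => -[|[|[|//]]] lti /=.
- have -> : Ordinal lti = 0 :> 'I_3 by exact: val_inj.
  by rewrite !(mul0r, addr0, add0r) ![x _ _ * _]mulrC [J 0 2 * _ + _]addrC.
- have -> : Ordinal lti = 1 :> 'I_3 by exact: val_inj.
  rewrite !(mul0r, addr0, add0r) ![x _ _ * _]mulrC (JC 1 0).
  by rewrite addrC -addrA.
- have -> : Ordinal lti = 2 :> 'I_3 by exact: val_inj.
  rewrite !(mul0r, addr0, add0r) ![x _ _ * _]mulrC (JC 2 0) (JC 2 1).
  by rewrite addrC addrAC addrC addrA [J 2 2 * _ + _]addrC.
Qed.

End RigidBody.

(* Main.v *)
Require Import Defs.
From HB Require Import structures.
From mathcomp Require Import all_boot all_order all_algebra.
From mathcomp Require Import all_classical all_reals all_analysis.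
From mathcomp Require Import ring lra.

Set Implicit Arguments.
Unset Strict Implicit.
Unset Printing Implicit Defensive.

Import Order.TTheory GRing.Theory Num.Theory.
Import numFieldNormedType.Exports.

Local Open Scope classical_set_scope.
Local Open Scope ring_scope.

(* The errors u_f - W_a theta, M - N theta and chi - theta all obey an equation
   x' = - k x with k >= 0, so their absolute values decrease; the first two
   vanish at 0, whence Y = Delta theta, and the third one bounds chi.  Likewise
   |Xi| decreases from 1.  For a fixed v, the function e^(bt) v^T N v has
   derivative e^(bt) |W_a v|^2, so N is positive semidefinite, Delta >= 0 and
   Delta_N >= 0.  If v^T N v vanished at T = ts + tc for some v <> 0, then
   W_a v would vanish on ]0, T], contradicting interval excitation; hence
   Delta(T) > 0.  Then |Xi(T)| < 1, since otherwise Xi^2 would be constant on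
   [0, T] although its derivative at T is - 2 Delta(T)^2.  The bound
   Delta_N >= k_N (1 - |Xi(T)|) persists after T. *)

(** * Calculus of derivatives on a half line *)

Section HalfLineCalculus.
Context {R : realType}.
Implicit Types (s t c : R) (f g df dg : R -> R).

Let half_filter (t0 t : R) : Filter (within [set h | t0 <= t + h] 0^').
Proof. exact: within_filter. Qed.

(** The difference quotient only sees [t + h] in the half line, which is also where the defining
    equations of the signals are given. *)
Lemma deriv_from_eq (V : normedModType R) (t0 : R) (x y dx dy : R -> V) :
    (forall t, t0 <= t -> x t = y t) -> (forall t, t0 <= t -> dx t = dy t) ->
  deriv_from t0 x dx -> deriv_from t0 y dy.
Proof.
move=> xy dxy dx_ t t0t; rewrite -dxy//; apply: cvg_trans (dx_ _ t0t).
apply: near_eq_cvg; rewrite near_withinE; near=> h => /= t0h.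
by rewrite !xy.
Unshelve. all: by end_near. Qed.

Lemma deriv_from_coord m n (t0 : R) (x dx : R -> 'M[R]_(m, n)) :
    deriv_from t0 x dx ->
  forall i j, deriv_from t0 (fun t => x t i j) (fun t => dx t i j).
Proof.
move=> dx_ i j t t0t.
have := cvg_comp _ _ (dx_ t t0t) (@coord_continuous _ m n i j (dx t)).
apply: cvg_trans; apply: near_eq_cvg; near=> h.
by rewrite /= !mxE.
Unshelve. all: by end_near. Qed.

Lemma deriv_from_cst (t0 : R) c : deriv_from t0 (fun=> c) (fun=> 0 : R).
Proof.
move=> t _; under eq_fun do rewrite subrr scaler0.
exact: cvg_cst.
Qed.

Lemma deriv_fromD (t0 : R) f g df dg :
  deriv_from t0 f df -> deriv_from t0 g dg ->
  deriv_from t0 (fun t => f t + g t) (fun t => df t + dg t).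
Proof.
move=> hf hg t t0t; have := cvgD (FF := half_filter t0 t) (hf t t0t) (hg t t0t).
apply: cvg_trans; apply: near_eq_cvg; near=> h.
rewrite /= -[LHS]scalerDr; congr (_ *: _); ring.
Unshelve. all: by end_near. Qed.

(** For [h != 0], [f (t + h)] is [h] times the difference quotient plus [f t], and the first term
    tends to [0 * df t]. *)
Lemma deriv_from_cvg (t0 : R) f df t : deriv_from t0 f df -> t0 <= t ->
  f (t + h) @[h --> within [set h | t0 <= t + h] 0^'] --> f t.
Proof.
move=> hf t0t.
have h0 : h @[h --> within [set h | t0 <= t + h] 0^'] --> (0 : R).
  apply: cvg_trans (@cvg_id _ (nbhs (0:R))).
  apply: cvg_trans; first exact: cvg_within.
  exact: cvg_within.
have FF := half_filter t0 t.
have := cvgD (FF := FF) (cvgM (FF := FF) h0 (hf t t0t))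
                        (cvg_cst (FF := FF) (f t)).
rewrite mul0r add0r; apply: cvg_trans; apply: near_eq_cvg.
rewrite near_withinE near_withinE; near=> h => h_neq0 _ /=.
rewrite -[LHS]/(h * (h^-1 * (f (t + h) - f t)) + f t).
by rewrite mulVKf// subrK.
Unshelve. all: by end_near. Qed.

Lemma deriv_fromM (t0 : R) f g df dg :
  deriv_from t0 f df -> deriv_from t0 g dg ->
  deriv_from t0 (fun t => f t * g t) (fun t => df t * g t + f t * dg t).
Proof.
move=> hf hg t t0t.
have FF := half_filter t0 t.
have := cvgD (FF := FF) (cvgM (FF := FF) (hf t t0t) (cvg_cst (FF := FF) (g t)))
                        (cvgM (FF := FF) (deriv_from_cvg hf t0t) (hg t t0t)).
apply: cvg_trans; apply: near_eq_cvg; near=> h.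
rewrite -[LHS]/(h^-1 * (f (t + h) - f t) * g t
                + f (t + h) * (h^-1 * (g (t + h) - g t))).
rewrite -[RHS]/(h^-1 * (f (t + h) * g (t + h) - f t * g t)); ring.
Unshelve. all: by end_near. Qed.

Lemma deriv_fromZ (t0 : R) c f df :
  deriv_from t0 f df -> deriv_from t0 (fun t => c * f t) (fun t => c * df t).
Proof.
move=> /(deriv_fromM (@deriv_from_cst t0 c)).
by apply: deriv_from_eq => // t _; rewrite mul0r add0r.
Qed.

Lemma deriv_from_sum n (t0 : R) (f df : 'I_n -> R -> R) :
    (forall i, deriv_from t0 (f i) (df i)) ->
  deriv_from t0 (fun t => \sum_i f i t) (fun t => \sum_i df i t).
Proof.
move=> hf; elim: (index_enum _) => [|i r IH].
  by apply: deriv_from_eq (@deriv_from_cst t0 0) => t _; rewrite big_nil.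
by apply: deriv_from_eq (deriv_fromD (hf i) IH) => t _; rewrite big_cons.
Qed.

(** Hypothesis and conclusion are both entrywise, so that products with constant matrices can be
    chained using scalar rules only. *)
Lemma deriv_from_mulmxl m n p (t0 : R) (A : 'M[R]_(m, n))
    (x dx : R -> 'M[R]_(n, p)) :
    (forall i j, deriv_from t0 (fun t => x t i j) (fun t => dx t i j)) ->
  forall i j,
    deriv_from t0 (fun t => (A *m x t) i j) (fun t => (A *m dx t) i j).
Proof.
move=> hx i j.
have := deriv_from_sum (fun k => deriv_fromZ (c := A i k) (hx k j)).
by apply: deriv_from_eq => t _; rewrite mxE.
Qed.

Lemma deriv_from_mulmxr m n p (t0 : R) (B : 'M[R]_(n, p))
    (x dx : R -> 'M[R]_(m, n)) :
    (forall i j, deriv_from t0 (fun t => x t i j) (fun t => dx t i j)) ->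
  forall i j,
    deriv_from t0 (fun t => (x t *m B) i j) (fun t => (dx t *m B) i j).
Proof.
move=> hx i j.
have := deriv_from_sum (fun k => deriv_fromZ (c := B k j) (hx i k)).
apply: deriv_from_eq => t _; rewrite mxE; apply: eq_bigr => k _; exact: mulrC.
Qed.

(** Away from [t0] the restriction [t0 <= t + h] holds for all small [h], so the limit is the
    ordinary two-sided one. *)
Lemma deriv_from_is_derive (t0 : R) f df t : deriv_from t0 f df -> t0 < t ->
  is_derive t 1 f (df t).
Proof.
move=> hf t0t.
have cv : h^-1 *: ((f \o shift t) (h *: 1) - f t) @[h --> 0^'] --> df t.
  have := hf t (ltW t0t).
  apply: cvg_trans => A /=; rewrite /nbhs /=.
  rewrite /within /= => hA.
  have t0h : \forall h \near 0^', t0 <= t + h.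
    near=> h.
    have : `|h| < t - t0.
      by near: h; apply: dnbhs0_lt; rewrite subr_gt0.
    by rewrite ltr_norml => /andP[? _]; lra.
  apply: filterS2 hA t0h => h /= hh /hh.
  suff -> : (h *: 1 + t : R) = t + h by [].
  by rewrite addrC; congr (_ + _); exact: mulr1.
split; first by apply: cvgP cv.
exact: cvg_lim cv.
Unshelve. all: by end_near. Qed.

Lemma deriv_from_continuous (t0 : R) f df : deriv_from t0 f df ->
  {within [set t | t0 <= t], continuous f}.
Proof.
move=> hf; apply/subspace_continuousP => t /= t0t.
have /cvgrPdist_lt hc := deriv_from_cvg hf t0t.
apply/cvgrPdist_lt => e e0; have := hc e e0.
rewrite !near_withinE => he.
change (\forall y \near t, t0 <= y -> `|f t - f y| < e); apply/nbhs0P.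
apply: filterS he => h /= he t0h.
have [->|h0] := eqVneq h 0; first by rewrite addr0 subrr normr0.
exact: he.
Qed.

(** * Monotonicity and decay from differential equations *)

Lemma deriv_from_homo (t0 : R) f df : deriv_from t0 f df ->
    (forall t, t0 <= t -> 0 <= df t) ->
  forall s t, t0 <= s -> s <= t -> f s <= f t.
Proof.
move=> hf df0 s t t0s st.
apply: (@ger0_derive1_le_cc _ f s t) => // [x|x|||]; rewrite ?in_itv/=.
- move=> /andP[sx _].
  by have [] := deriv_from_is_derive hf (le_lt_trans t0s sx).
- move=> /andP[sx _]; have t0x := le_lt_trans t0s sx.
  have fx := deriv_from_is_derive hf t0x.
  by rewrite derive1E derive_val df0// ltW.
- apply: continuous_subspaceW (deriv_from_continuous hf) => x /=.
  by rewrite in_itv/= => /andP[sx _]; exact: le_trans sx.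
- by rewrite lexx st.
- by rewrite lexx st.
Qed.

(** Only left difference quotients are used. This covers the end point [T], beyond which nothing is
    known of [f]. *)
Lemma deriv_from_const_eq0 (t0 : R) f df c T : deriv_from t0 f df ->
    (forall t, t0 <= t -> t <= T -> f t = c) ->
  forall t, t0 < t -> t <= T -> df t = 0.
Proof.
move=> hf fc t t0t tT; have := hf t (ltW t0t) => hft.
have h1 : h^-1 *: (f (t + h) - f t) @[h --> 0^'-] --> df t.
  apply: cvg_trans hft => A /=; rewrite /nbhs /= /within /= => hA.
  have : \forall h \near (0 : R), t0 - t < h.
    have tt0 : 0 < t - t0 by rewrite subr_gt0.
    apply: filterS (@nbhs0_lt _ R _ tt0) => h.
    by rewrite ltr_norml => /andP[? _]; lra.
  move: hA; rewrite !near_withinE; apply: filterS2 => h hA t0h h0.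
  apply: hA; first by rewrite lt_eqF.
  by move: t0h; rewrite /= ltrBlDl => /ltW.
apply: (cvg_unique _ h1); first exact: norm_hausdorff.
apply: cvg_near_cst; near=> h.
have h0 : h < 0 by near: h; exact: nbhs_left_lt.
have : t0 - t < h by near: h; apply: nbhs_left_gt; rewrite subr_lt0.
rewrite ltrBlDl => t0h.
by rewrite !fc ?subrr ?scaler0//; lra.
Unshelve. all: by end_near. Qed.

(** The derivative of [- f ^+ 2] is [2 * k * f ^+ 2 >= 0], so [f ^+ 2] is nonincreasing; neither an
    explicit solution nor an integral of [k] enters. *)
Lemma decay_norm_le (t0 : R) f df (k : R -> R) : deriv_from t0 f df ->
    (forall t, t0 <= t -> df t = - k t * f t) ->
    (forall t, t0 <= t -> 0 <= k t) ->
  forall s t, t0 <= s -> s <= t -> `|f t| <= `|f s|.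
Proof.
move=> hf dfE k0 s t t0s st.
rewrite -(ler_pXn2r (n := 2)) ?nnegrE// !real_normK ?num_real//.
have df2_ge0 r : t0 <= r -> 0 <= -1 * (df r * f r + f r * df r).
  move=> t0r; rewrite dfE//; have := mulr_ge0 (k0 _ t0r) (sqr_ge0 (f r)).
  by rewrite expr2; nra.
have := deriv_from_homo (deriv_fromZ (c := -1) (deriv_fromM hf hf))
  df2_ge0 t0s st.
by rewrite !mulN1r lerN2 -!expr2.
Qed.

(** This serves as the uniqueness theorem for linear equations: it turns equal initial values into
    identities between filtered signals. *)
Lemma decay_eq0 (t0 : R) f c df : deriv_from t0 f df -> 0 <= c ->
    (forall t, t0 <= t -> df t = - c * f t) -> f t0 = 0 ->
  forall t, t0 <= t -> f t = 0.
Proof.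
move=> hf c0 dfE f0 t t0t; apply/eqP; rewrite -normr_le0 -(normr0 R) -f0.
exact: (decay_norm_le hf dfE).
Qed.

Lemma is_derive_deriv_from (t0 : R) f df :
  (forall t, is_derive t 1 f (df t)) -> deriv_from t0 f df.
Proof.
move=> hf t _; have [df_ <-] := hf t.
apply: cvg_within_filter; apply: cvg_trans df_.
apply: near_eq_cvg; near=> h => /=.
suff -> : (h *: 1 + t : R) = t + h by [].
by rewrite addrC; congr (_ + _); exact: mulr1.
Unshelve. all: by end_near. Qed.

Lemma deriv_from_expR (t0 : R) c :
  deriv_from t0 (fun t => expR (c * t)) (fun t => c * expR (c * t)).
Proof.
apply: is_derive_deriv_from => t.
have dlin : is_derive t 1 ( *%R c) c.
  have := is_deriveM (is_derive_cst c t 1) (is_derive_id t (1 : R)).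
  rewrite scaler0 addr0 [_ *: _]mulr1; exact.
rewrite mulrC.
exact: (@is_derive1_comp _ expR ( *%R c) t _ c (is_derive_expR _) dlin).
Qed.

End HalfLineCalculus.

Arguments deriv_from_cst {R} t0 c.
Arguments deriv_from_expR {R} t0 c.
Arguments deriv_fromZ {R t0} c {f df} _.
Arguments deriv_from_coord {R m n t0 x dx} _ i j.
Arguments deriv_from_mulmxl {R m n p t0} A {x dx} _ i j.
Arguments deriv_from_mulmxr {R m n p t0} B {x dx} _ i j.

(** * Quadratic forms, determinants and matrix integrals *)

Section MatrixFacts.
Context {R : realType}.

Lemma mxnorm_le m n (A B : 'M[R]_(m, n)) :
  (forall i j, `|A i j| <= `|B i j|) -> `|A| <= `|B|.
Proof.
move=> AB; rewrite -![`|_|]/(mx_norm _) !mx_normrE.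
apply: bigmax_le => [|[i j] _ /=]; first exact: bigmax_ge_id.
exact: le_trans (AB i j) (le_bigmax _ (fun ij => `|B ij.1 ij.2|) (i, j)).
Qed.

Lemma quad0 n (v : 'cV[R]_n) : quad 0 v = 0.
Proof. by rewrite /quad mulmx0 mul0mx mxE. Qed.

Lemma quadD n (A B : 'M[R]_n) v : quad (A + B) v = quad A v + quad B v.
Proof. by rewrite /quad mulmxDr mulmxDl mxE. Qed.

Lemma quadZ n c (A : 'M[R]_n) v : quad (c *: A) v = c * quad A v.
Proof. by rewrite /quad -scalemxAr -scalemxAl mxE. Qed.

Lemma quad_scalar n c v : quad (c%:M : 'M[R]_n) v = c * \sum_i v i 0 ^+ 2.
Proof.
rewrite -scalemx1 quadZ /quad mulmx1 mxE; congr (_ * _).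
by apply: eq_bigr => i _; rewrite mxE.
Qed.

Lemma quad_gram m n (A : 'M[R]_(m, n)) v :
  quad (A^T *m A) v = \sum_i (A *m v) i 0 ^+ 2.
Proof.
rewrite /quad -!mulmxA [v^T *m _]mulmxA -trmx_mul mxE.
by apply: eq_bigr => i _; rewrite mxE.
Qed.

Lemma sum_sqr_ge0 n (v : 'cV[R]_n) : 0 <= \sum_i v i 0 ^+ 2.
Proof. by apply: sumr_ge0 => i _; exact: sqr_ge0. Qed.

Lemma sum_sqr_eq0 n (v : 'cV[R]_n) : \sum_i v i 0 ^+ 2 = 0 -> v = 0.
Proof.
move=> /psumr_eq0P h; apply/colP => i; rewrite mxE; apply/eqP.
by rewrite -sqrf_eq0 h// => k _; exact: sqr_ge0.
Qed.

Lemma sum_sqr_gt0 n (v : 'cV[R]_n) : v != 0 -> 0 < \sum_i v i 0 ^+ 2.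
Proof.
move=> v0; rewrite lt_def sum_sqr_ge0 andbT.
by apply: contra v0 => /eqP /sum_sqr_eq0 ->.
Qed.

Lemma posdef_det_neq0 n (A : 'M[R]_n) : posdef A -> \det A != 0.
Proof.
move=> Apd; apply/negP => /det0P[v v0 vA].
have := Apd v^T; rewrite trmx_eq0 => /(_ v0).
by rewrite /quad trmxK vA mul0mx mxE ltxx.
Qed.

(** Seen as a polynomial in [s], the determinant along a line of matrices is open to the
    intermediate value theorem for polynomials. *)
Lemma horner_det_pencil n (A B : 'M[R]_n) s :
  (\det (map_mx polyC A + 'X *: map_mx polyC B)).[s] = \det (A + s *: B).
Proof.
rewrite -[LHS]/(horner_eval s _) -det_map_mx; congr (\det _).
apply/matrixP => i j; rewrite !mxE.
by rewrite -[LHS]/(((A i j)%:P + 'X * (B i j)%:P).[s]) hornerD hornerM hornerX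
  !hornerC.
Qed.

(** Continuity argument: every matrix on the segment from the identity to [A] is positive definite,
    so the determinant, which is 1 at the start, cannot vanish and change sign. *)
Lemma posdef_det_gt0 n (A : 'M[R]_n) : posdef A -> 0 < \det A.
Proof.
move=> Apd; rewrite ltNge; apply/negP => detA.
(* The sign is reversed because [poly_ivt] wants a value [<= 0] on the left and [>= 0] on the
   right. *)
set p : {poly R} :=
  - \det (map_mx polyC 1%:M + 'X *: map_mx polyC (A - 1%:M)).
have pE s : p.[s] = - \det ((1 - s)%:M + s *: A).
  rewrite hornerN horner_det_pencil; congr (- \det _).
  by rewrite scalerBr addrCA addrC scalemx1 raddfB.
have [||s /andP[s0 s1]] := @poly_ivt _ p 0 1.
- exact: ler01.
- by rewrite !pE scale0r addr0 subr0 det1 subrr raddf0 add0r scale1r oppr_ge0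
    detA lerN10.
rewrite /root pE oppr_eq0; apply/negP/posdef_det_neq0 => v v0.
rewrite quadD quadZ quad_scalar.
have := Apd v v0; have := sum_sqr_gt0 v0; nra.
Qed.

(** Adding [s *: 1%:M] with [s > 0] makes [A] positive definite. A negative determinant at [s = 0]
    would force a root in [[0, 1]], but 0 is not a root and positive [s] give positive values. *)
Lemma possemidef_det_ge0 n (A : 'M[R]_n) : possemidef A -> 0 <= \det A.
Proof.
move=> Apsd; rewrite leNgt; apply/negP => detA.
set p : {poly R} := \det (map_mx polyC A + 'X *: map_mx polyC 1%:M).
have pE s : p.[s] = \det (A + s *: 1%:M) by exact: horner_det_pencil.
have p_gt0 s : 0 < s -> 0 < p.[s].
  move=> s0; rewrite pE; apply: posdef_det_gt0 => v v0.
  rewrite quadD quadZ quad_scalar mul1r ltr_wpDl//.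
  by rewrite mulr_gt0// sum_sqr_gt0.
have [||s /andP[s0 s1] /eqP ps0] := @poly_ivt _ p 0 1.
- exact: ler01.
- by rewrite {1}pE scale0r addr0 !ltW// p_gt0.
have [s_eq0|s_neq0] := eqVneq s 0.
  by move: ps0 detA; rewrite s_eq0 pE scale0r addr0 => ->; rewrite ltxx.
by have := p_gt0 s; rewrite ps0 ltxx lt_def s_neq0 s0 => /(_ isT).
Qed.

(** The constant factor [B] moves under the integral; integrability of the entries justifies
    exchanging it with the finite sum. *)
Lemma mxintegral_mul_eq0 m n p (D : set R) (F : R -> 'M[R]_(m, n))
    (B : 'M[R]_(n, p)) :
  measurable (D : set (measurableTypeR R)) ->
  (forall i j, lebesgue_measure.-integrable D (EFin \o (fun t => F t i j))) ->
  (forall t, D t -> F t *m B = 0) -> mxintegral D F *m B = 0.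
Proof.
move=> mD intF FB; apply/matrixP => i j; rewrite !mxE.
have intFB k : lebesgue_measure.-integrable D
    (EFin \o (fun t => F t i k * B k j)).
  have := integrableZr mD (B k j) (intF i k).
  by apply: eq_integrable.
transitivity (\int[lebesgue_measure]_(t in D) \sum_k (F t i k * B k j)).
  transitivity (\sum_k \int[lebesgue_measure]_(t in D) (F t i k * B k j)).
    by apply: eq_bigr => k _; rewrite mxE RintegralZr.
  rewrite /Rintegral; under [in RHS]eq_integral do rewrite -sumEFin.
  rewrite integral_sum// -[LHS]/(fine (_)%:E) -sumEFin; congr fine.
  by apply: eq_bigr => k _; rewrite fineK//;
    apply: integrable_fin_num (intFB k).
transitivity (\int[lebesgue_measure]_(t in D) (0 : R)).
  apply: eq_Rintegral => t; rewrite inE => /FB/matrixP/(_ i j).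
  by rewrite !mxE.
by rewrite /Rintegral integral0.
Qed.

End MatrixFacts.

(** * Stability of the scalar filter, and Gramians with forgetting *)

Section Filters.
Context {R : realType}.

Lemma deriv_from_Lmx (t0 : R) (x dx : R -> 'cV[R]_3) :
    (forall i j, deriv_from t0 (fun t => x t i j) (fun t => dx t i j)) ->
  forall i j,
    deriv_from t0 (fun t => Lmx (x t) i j) (fun t => Lmx (dx t) i j).
Proof.
move=> hx [[|[|[|//]]] lti] [[|[|[|[|[|[|//]]]]]] ltj];
  first [ by apply: deriv_from_eq (hx 0 0) => t _; rewrite mxE
        | by apply: deriv_from_eq (hx 1 0) => t _; rewrite mxE
        | by apply: deriv_from_eq (hx 2 0) => t _; rewrite mxE
        | by apply: deriv_from_eq (deriv_from_cst t0 0) => t _; rewrite mxE].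
Qed.

Lemma bounded_signal_mx m n (x : R -> 'M[R]_(m, n)) (C : 'M[R]_(m, n)) :
    (forall t, 0 <= t -> forall i j, `|x t i j| <= `|C i j|) ->
  bounded_signal x.
Proof.
move=> xC; apply/ex_bound.
  by apply: (@globally_properfilter _ _ 0); rewrite /= in_itv/= lexx.
exists `|C| => t /=.
by rewrite in_itv/= andbT => t0; apply: mxnorm_le; exact: xC.
Qed.

(** Each coordinate decays separately and the matrix norm is the largest absolute value of an entry,
    so [delta = eps] works. *)
Lemma scalar_ltv_stable p (D : R -> R) :
  zero_lyapunov_stable (fun t (x : 'cV[R]_p) => - D t ^+ 2 *: x).
Proof.
move=> t0 eps _ eps0; exists eps => // x hx xt0 t t0t.
apply: le_lt_trans xt0; apply: mxnorm_le => i j.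
have D2_ge0 r : t0 <= r -> 0 <= D r ^+ 2 by move=> _; exact: sqr_ge0.
have xijE r : t0 <= r ->
    (- D r ^+ 2 *: x r) i j = - (D r ^+ 2) * x r i j by rewrite mxE.
exact: (decay_norm_le (deriv_from_coord hx i j) xijE D2_ge0 (lexx t0) t0t).
Qed.

Section Gram.
Variables (b : R) (m n : nat) (A : R -> 'M[R]_(m, n)) (N : R -> 'M[R]_n).
Hypothesis N_eq : deriv_from 0 N (fun t => - b *: N t + (A t)^T *m A t).
Hypothesis N_init : N 0 = 0.

(* Multiplying by the integrating factor [expR (b * t)] removes the
   forgetting term [- b *: N]. *)
Lemma gram_quad_deriv v :
  deriv_from 0 (fun t => expR (b * t) * quad (N t) v)
    (fun t => expR (b * t) * \sum_i (A t *m v) i 0 ^+ 2).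
Proof.
have hN := deriv_from_mulmxl v^T (deriv_from_coord N_eq).
have hq := deriv_from_mulmxr v hN 0 0.
apply: deriv_from_eq (deriv_fromM (deriv_from_expR 0 b) hq) => // t _.
rewrite -[X in _ + _ * X]/(quad _ v) quadD quadZ quad_gram.
rewrite -[X in _ * X + _]/(quad _ v); ring.
Qed.

Arguments gram_quad_deriv : clear implicits.

Lemma gram_quad_homo v s t : 0 <= s -> s <= t ->
  expR (b * s) * quad (N s) v <= expR (b * t) * quad (N t) v.
Proof.
move=> s0 st; apply: (deriv_from_homo (gram_quad_deriv v)) => // r _.
by rewrite mulr_ge0 ?expR_ge0 ?sum_sqr_ge0.
Qed.

Lemma gram_possemidef t : 0 <= t -> possemidef (N t).
Proof.
move=> t0 v; have := gram_quad_homo v (lexx 0) t0.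
by rewrite N_init quad0 mulr0 pmulr_rge0 ?expR_gt0.
Qed.

(** The weighted form is nonnegative and nondecreasing, so if it is 0 at [T] it is 0 on all of
    [[0, T]], and so is its derivative after time 0. *)
Lemma gram_quad_eq0 v T : 0 <= T -> quad (N T) v = 0 ->
  forall t, 0 < t -> t <= T -> A t *m v = 0.
Proof.
move=> T0 qT t t0 tT; apply: sum_sqr_eq0.
have q0 r : 0 <= r -> r <= T -> expR (b * r) * quad (N r) v = 0.
  move=> r0 rT; apply/eqP; rewrite eq_le.
  rewrite mulr_ge0 ?expR_ge0 ?gram_possemidef// andbT.
  by have := gram_quad_homo v r0 rT; rewrite qT mulr0.
have /eqP := deriv_from_const_eq0 (gram_quad_deriv v) q0 t0 tT.
by rewrite mulf_eq0 gt_eqF ?expR_gt0//= => /eqP.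
Qed.

Lemma gram_posdef dA (ts tc : R) :
    (forall i j, deriv_from 0 (fun t => A t i j) (fun t => dA t i j)) ->
    0 < ts -> 0 < tc -> interval_excitation (fun t => (A t)^T) ts tc ->
  posdef (N (ts + tc)).
Proof.
move=> hA ts0 tc0 [_ [nu nu0 ie]] v v0.
have T0 : 0 <= ts + tc by rewrite addr_ge0// ltW.
rewrite lt_def gram_possemidef// andbT; apply/negP => /eqP qT.
have Av := gram_quad_eq0 T0 qT.
have := ie v; rewrite -scaleN1r quadD quadZ quad_scalar.
rewrite [quad (mxintegral _ _) v](_ : _ = 0); last first.
  rewrite /quad -mulmxA mxintegral_mul_eq0 ?mulmx0 ?mxE//.
  (* The entries of [A] are differentiable, so those of the integrand are continuous on a compact
     interval, hence integrable. *)
  - move=> i j.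
    apply: continuous_compact_integrable; first exact: segment_compact.
    have hAA : deriv_from 0 (fun t => \sum_k A t k i * A t k j)
      (fun t => \sum_k (dA t k i * A t k j + A t k i * dA t k j)).
      by apply: deriv_from_sum => k; exact: deriv_fromM.
    have /deriv_from_continuous h : deriv_from 0
        (fun t => ((A t)^T *m ((A t)^T)^T) i j)
        (fun t => \sum_k (dA t k i * A t k j + A t k i * dA t k j)).
      apply: deriv_from_eq hAA => // t _; rewrite mxE.
      by apply: eq_bigr => k _; rewrite !mxE.
    apply: continuous_subspaceW h => t /=.
    by rewrite in_itv/= => /andP[+ _]; exact/le_trans/ltW.
  - move=> t /=; rewrite in_itv/= => /andP[tst tT].
    by rewrite trmxK -mulmxA Av ?mulmx0// (lt_le_trans ts0).
have := mulr_gt0 nu0 (sum_sqr_gt0 v0); lra.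
Qed.

End Gram.

End Filters.

Arguments deriv_from_Lmx {R t0 x dx} _ i j.

(** * Regression identities of the rigid body and bounds on the extended regressor *)

Theorem lemma3 (R : realType)
  (* rigid body: inertia, angular velocity and its derivative, torque *)
  (J : 'M[R]_3) (w dw u : R -> 'cV[R]_3)
  (* constants *)
  (a b kI kN : R)
  (* filtered signals (dwf is the derivative of wf) *)
  (wf dwf uf : R -> 'cV[R]_3) (W Wf Wa : R -> 'M[R]_(3, 6))
  (M : R -> 'cV[R]_6) (N : R -> 'M[R]_6)
  (Y : R -> 'cV[R]_6) (Delta : R -> R)
  (* LTV filter *)
  (chi : R -> 'cV[R]_6) (Xi : R -> R) (DeltaN : R -> R)
  (J_sym : J^T = J) (J_posdef : posdef J) (J_diag : is_diag_mx J)
  (a_gt0 : 0 < a) (b_gt0 : 0 < b) (kI_ge1 : 1 <= kI) (kN_gt0 : 0 < kN)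
  (w_deriv : deriv_from 0 w dw)
  (dynamics : forall t, 0 <= t ->
     J *m dw t = - cross_mx (w t) *m J *m w t + u t)
  (wf_deriv : deriv_from 0 wf dwf)
  (wf_eq : forall t, 0 <= t -> dwf t = - a *: wf t + w t)
  (wf_init : wf 0 = a^-1 *: w 0)
  (W_def : forall t, 0 <= t -> W t = - cross_mx (w t) *m Lmx (w t))
  (Wf_eq : deriv_from 0 Wf (fun t => - a *: Wf t + W t))
  (Wf_init : Wf 0 = 0)
  (uf_eq : deriv_from 0 uf (fun t => - a *: uf t + u t))
  (uf_init : uf 0 = 0)
  (Wa_def : forall t, 0 <= t -> Wa t = Lmx (dwf t) - Wf t)
  (M_eq : deriv_from 0 M (fun t => - b *: M t + (Wa t)^T *m uf t))
  (M_init : M 0 = 0)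
  (N_eq : deriv_from 0 N (fun t => - b *: N t + (Wa t)^T *m Wa t))
  (N_init : N 0 = 0)
  (Y_def : forall t, 0 <= t -> Y t = kI *: (\adj (N t) *m M t))
  (Delta_def : forall t, 0 <= t -> Delta t = kI * \det (N t))
  (chi_eq : deriv_from 0 chi
     (fun t => Delta t *: (Y t - Delta t *: chi t)))
  (Xi_eq : deriv_from 0 Xi (fun t => - (Delta t) ^+ 2 * Xi t))
  (Xi_init : Xi 0 = 1)
  (DeltaN_def : forall t, 0 <= t -> DeltaN t = Delta t + kN * (1 - Xi t)) :
  [/\ internally_stable Delta chi Xi,
      forall t, 0 <= t -> 0 <= DeltaN t
    & forall ts tc : R, 0 < ts -> 0 < tc ->
        interval_excitation (fun t => (Wa t)^T) ts tc ->
        exists2 hbar : R, 0 < hbar &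
          forall t, ts + tc <= t -> hbar < DeltaN t].
Proof.
(* Derivative of [Wa]: the filter equation [dwf = - a *: wf + w] is differentiated once more. *)
set dWa := fun t => Lmx (- a *: dwf t + dw t) - (- a *: Wf t + W t).
have dwf_deriv i j : deriv_from 0 (fun t => dwf t i j)
    (fun t => (- a *: dwf t + dw t) i j).
  have := deriv_fromD (deriv_fromZ (- a) (deriv_from_coord wf_deriv i j))
                      (deriv_from_coord w_deriv i j).
  by apply: deriv_from_eq => t t0; rewrite ?wf_eq// !mxE.
have Wa_deriv i j : deriv_from 0 (fun t => Wa t i j) (fun t => dWa t i j).
  have := deriv_fromD (deriv_from_Lmx dwf_deriv i j)
                      (deriv_fromZ (-1) (deriv_from_coord Wf_eq i j)).
  by apply: deriv_from_eq => t t0; rewrite ?Wa_def// /dWa mulN1r [RHS]mxE;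
    congr (_ + _); rewrite [RHS]mxE.
have Wtheta t : 0 <= t -> W t *m theta J = J *m dw t - u t.
  move=> t0; rewrite W_def// -mulmxA -Lmx_theta// dynamics// !mulmxA.
  by rewrite addrK.
have ufE t : 0 <= t -> uf t = Wa t *m theta J.
  move=> t0; apply/colP => i; apply/esym/eqP; rewrite -subr_eq0 -mulN1r.
  (* The error [z = Wa theta - uf] satisfies [z' = - a z]: by [Wtheta], the terms in [J *m dw] and
     [u] cancel. *)
  have hz := deriv_fromD (deriv_from_mulmxr (theta J) Wa_deriv i 0)
    (deriv_fromZ (-1) (deriv_from_coord uf_eq i 0)).
  apply/eqP; apply: (decay_eq0 hz (ltW a_gt0)) t0.
  - move=> {}t t0; rewrite Wa_def//.
    rewrite /dWa !mulmxBl mulmxDl -!Lmx_theta// mulmxDr Wtheta//.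
    rewrite -scalemxAl -scalemxAr.
    (* The products are made opaque so that [mxE] does not expand them into sums. *)
    move: (J *m dwf t) (J *m dw t) (Wf t *m theta J) => A B C.
    by rewrite !mxE; ring.
  (* The choice [wf 0 = a^-1 *: w 0] gives [dwf 0 = 0], so the error starts at 0. *)
  - rewrite Wa_def// wf_eq// Wf_init uf_init wf_init subr0.
    rewrite scalerA mulNr mulfV ?gt_eqF// scaleN1r addNr -Lmx_theta//.
    by rewrite mulmx0 !mxE mulr0 addr0.
have MN t : 0 <= t -> M t = N t *m theta J.
  move=> t0; apply/colP => i; apply/esym/eqP; rewrite -subr_eq0 -mulN1r.
  have hz := deriv_fromD
    (deriv_from_mulmxr (theta J) (deriv_from_coord N_eq) i 0)
    (deriv_fromZ (-1) (deriv_from_coord M_eq i 0)).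
  apply/eqP; apply: (decay_eq0 hz (ltW b_gt0)) t0.
  - move=> {}t t0; rewrite ufE// mulmxDl -scalemxAl mulmxA.
    move: (N t *m theta J) ((Wa t)^T *m (Wa t *m theta J)) => A B.
    by rewrite !mxE; ring.
  - by rewrite N_init M_init mul0mx !mxE mulr0 addr0.
have YE t : 0 <= t -> Y t = Delta t *: theta J.
  move=> t0; rewrite Y_def// MN// mulmxA mul_adj_mx mul_scalar_mx.
  by rewrite scalerA Delta_def.
have D2_ge0 t : 0 <= t -> 0 <= Delta t ^+ 2 by move=> _; exact: sqr_ge0.
have Xi_noninc := decay_norm_le Xi_eq (fun t _ => erefl) D2_ge0.
have Xi_le1 t : 0 <= t -> `|Xi t| <= 1.
  by move=> t0; have := Xi_noninc 0 t (lexx 0) t0; rewrite Xi_init normr1.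
have Npsd t : 0 <= t -> possemidef (N t).
  exact: (gram_possemidef N_eq N_init).
have kI_gt0 : 0 < kI by exact: lt_le_trans kI_ge1.
have Delta_ge0 t : 0 <= t -> 0 <= Delta t.
  move=> t0; rewrite Delta_def// pmulr_rge0//.
  by apply: possemidef_det_ge0; exact: Npsd.
split.
- split; first exact: scalar_ltv_stable.
  + have chi_err t i : 0 <= t ->
        `|chi t i 0 - theta J i 0| <= `|chi 0 i 0 - theta J i 0|.
      (* As [theta J] is constant and [Y = Delta theta], the error [chi - theta] obeys the
         homogeneous equation with rate [Delta ^+ 2]. *)
      have hz := deriv_fromD (deriv_from_coord chi_eq i 0)
        (deriv_from_cst 0 (- theta J i 0)).
      apply: (decay_norm_le hz _ D2_ge0) => // r r0.
      by rewrite YE// !mxE; ring.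
    apply: (bounded_signal_mx (C := \col_i
      (`|theta J i 0| + `|chi 0 i 0 - theta J i 0|))) => t t0 i j.
    rewrite ord1 mxE [leRHS]ger0_norm// -[chi t i 0](subrK (theta J i 0)).
    by rewrite addrC (le_trans (ler_normD _ _))// lerD2l chi_err.
  + apply/ex_bound.
      by apply: (@globally_properfilter _ _ 0); rewrite /= in_itv/= lexx.
    by exists 1 => t /=; rewrite in_itv/= andbT; exact: Xi_le1.
- move=> t t0; rewrite DeltaN_def// addr_ge0 ?Delta_ge0//.
  by rewrite pmulr_rge0// subr_ge0 (le_trans (ler_norm _)) ?Xi_le1.
move=> ts tc ts0 tc0 ie; set T := ts + tc.
have T_gt0 : 0 < T by rewrite addr_gt0.
have DeltaT : 0 < Delta T.
  rewrite Delta_def ?ltW// mulr_gt0//; apply: posdef_det_gt0.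
  exact: (gram_posdef N_eq N_init Wa_deriv).
have XiT : `|Xi T| < 1.
  rewrite lt_neqAle Xi_le1 ?ltW// andbT; apply/negP => /eqP XiT.
  (* [|Xi|] is nonincreasing and at most 1, so the value 1 at [T] forces the value 1 on the whole
     interval. *)
  have Xi2 r : 0 <= r -> r <= T -> Xi r * Xi r = 1.
    move=> r0 rT; rewrite -expr2 -real_normK ?num_real//.
    suff -> : `|Xi r| = 1 by rewrite expr1n.
    by apply/eqP; rewrite eq_le Xi_le1//= -XiT Xi_noninc.
  have := deriv_from_const_eq0 (deriv_fromM Xi_eq Xi_eq) Xi2 T_gt0 (lexx T).
  have := Xi2 T (ltW T_gt0) (lexx T).
  (* The derivative [- 2 * Delta T ^+ 2 * Xi T ^+ 2] would be 0 although both squares are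
     positive. *)
  have := exprn_gt0 2 DeltaT; nra.
(* Halving the lower bound [kN * (1 - |Xi T|)] makes the required inequality strict. *)
exists (kN * (1 - `|Xi T|) / 2).
  by rewrite !mulr_gt0// subr_gt0.
move=> t tT; have t0 := le_trans (ltW T_gt0) tT; rewrite DeltaN_def//.
have := le_trans (ler_norm _) (Xi_noninc T t (ltW T_gt0) tT).
have := Delta_ge0 t t0.
have := mulr_gt0 kN_gt0; nra.
Qed.
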